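(* Let $L$ be a finite-dimensional (right) Leibniz algebra over an algebraically closed field $F$ of characteristic zero, and assume $L$ is a Killing Leibniz algebra, i.e. for all $x,y\in L$ the trace of the restriction $(ad_x\circ ad_y)_{|\mathrm{Ess}(L)}$ is zero. Let $\ker(\mathfrak{K})=\{x\in L:\ \mathrm{tr}(ad_x\circ ad_y)=0 \text{ for all } y\in L\}$ be the kernel of the Killing form of $L$. Then $\ker(\mathfrak{K})=\mathrm{Ess}(L)$ if and only if $L$ is semisimple.
   Context: A (right) Leibniz algebra is a vector space $L$ with a bilinear bracket satisfying $[x,[y,z]]=[[x,y],z]-[[x,z],y]$ for all $x,y,z\in L$. For $x\in L$, $ad_x:L\to L$ is $ad_x(y)=[y,x]$. The Killing form is $\mathfrak{K}(x,y)=\mathrm{tr}(ad_x\circ ad_y)$. $\mathrm{Ess}(L)$ denotes the linear span of all squares $[x,x]$, $x\in L$; it is a two-sided ideal, hence invariant under each $ad_x\circ ad_y$. For subspaces $X,Y$, $[X,Y]$ is the span of all $[u,v]$, $u\in X,v\in Y$. The derived series is $D^1(L)=[L,L]$, $D^{n+1}(L)=[D^n(L),D^n(L)]$; $L$ is solvable if $D^m(L)=0$ for some $m\ge1$. $\mathrm{Rad}(L)$ is the largest solvable (two-sided) ideal of $L$. $L$ is called semisimple if $\mathrm{Rad}(L)=\mathrm{Ess}(L)$. *)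

(* Defs.v *)
From HB Require Import structures.
From mathcomp Require Import all_boot all_order all_algebra.
Set Implicit Arguments. Unset Strict Implicit. Unset Printing Implicit Defensive.
Import GRing.Theory.
Local Open Scope ring_scope.

Section Leibniz.
Variables (F : fieldType) (L : vectType F).

Definition bilinear_br (br : L -> L -> L) : Prop :=
  (forall (a : F) x y z, br (a *: x + y) z = a *: br x z + br y z) /\
  (forall (a : F) x y z, br z (a *: x + y) = a *: br z x + br z y).

Definition leibniz_identity (br : L -> L -> L) : Prop :=
  forall x y z, br x (br y z) = br (br x y) z - br (br x z) y.

Definition ad (br : L -> L -> L) (x : L) : L -> L := fun y => br y x.

(* trace of (the restriction to U of) an endomorphism f stabilizing U,
   computed in the basis vbasis U of U *)
Definition trace_on (U : {vspace L}) (f : L -> L) : F :=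
  \sum_(i < \dim U) coord (vbasis U) i (f (vbasis U)`_i).

Definition killing (br : L -> L -> L) (x y : L) : F :=
  trace_on fullv (ad br x \o ad br y).

Definition is_Ess (br : L -> L -> L) (E : {vspace L}) : Prop :=
  (forall x, br x x \in E) /\
  (forall U : {vspace L}, (forall x, br x x \in U) -> (E <= U)%VS).

(* [X,Y] = span of all [u,v], u in X, v in Y (by bilinearity, spanned by
   brackets of basis vectors) *)
Definition brs (br : L -> L -> L) (X Y : {vspace L}) : {vspace L} :=
  <<[seq br u v | u <- vbasis X, v <- vbasis Y]>>%VS.

Definition derived (br : L -> L -> L) (n : nat) (I : {vspace L}) :
  {vspace L} := iter n (fun X => brs br X X) I.

Definition solvable_sub (br : L -> L -> L) (I : {vspace L}) : Prop :=
  exists m, (1 <= m)%N /\ derived br m I = 0%VS.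

Definition two_sided_ideal (br : L -> L -> L) (I : {vspace L}) : Prop :=
  forall x y, x \in I -> br x y \in I /\ br y x \in I.

Definition is_Rad (br : L -> L -> L) (R : {vspace L}) : Prop :=
  [/\ two_sided_ideal br R, solvable_sub br R &
      forall I, two_sided_ideal br I -> solvable_sub br I -> (I <= R)%VS].

Definition semisimple (br : L -> L -> L) : Prop :=
  exists R E, [/\ is_Rad br R, is_Ess br E & R = E].

Definition killing_leibniz (br : L -> L -> L) (E : {vspace L}) : Prop :=
  forall x y, trace_on E (ad br x \o ad br y) = 0.

End Leibniz.

(* Main.v *)
(* The kernel [N] of the Killing form is a two-sided ideal containing [Ess L].

   If [N = Ess L], let [I] be a solvable ideal: going up its derived series, an
   ideal [J] with [[J, J] <= Ess L] lies in [N], because [ad x \o ad y] with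
   [x \in J] maps [L] to [J], [J] to [Ess L] and [Ess L] to itself with trace
   zero. So [I <= Ess L].

   Conversely [N] is solvable by Cartan's criterion, hence [N <= Rad L = Ess L].
   The elements of [ad [N, N]] are nilpotent: if [x] is one of them, with
   eigenvalues [lam i], then for any [Q]-linear functional [f] on the span of
   the [lam i] the matrix [y] acting as [f (lam i)] on the generalized
   eigenspaces of [x] normalizes [ad N], so that
   [0 = \tr (x * y) = \sum_i m i * lam i * f (lam i)]; applying [f] again gives
   [f (lam i) = 0]. By Engel's theorem the words of some length [k] in
   [ad [N, N]] vanish, so the derived series of [N] stops. *)
Require Import Defs.
From HB Require Import structures.
From Stdlib Require Import Classical.
From mathcomp Require Import all_boot all_order all_algebra ring.
Set Implicit Arguments. Unset Strict Implicit. Unset Printing Implicit Defensive.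
Import GRing.Theory Num.Theory.
Local Open Scope ring_scope.

(** * Subspaces cut out by linear predicates *)

Lemma dimv_add_line (F : fieldType) (V : vectType F) (U : {vspace V}) v :
  v \notin U -> (\dim U < \dim (U + <[v]>))%N.
Proof.
move=> vU; rewrite ltn_neqAle dimvS ?addvSl // andbT.
apply: contra vU => /eqP dUv.
suff -> : U = (U + <[v]>)%VS by rewrite memvE addvSr.
by apply/eqP; rewrite eqEdim addvSl dUv leqnn.
Qed.

(** Starting from [0], a vector satisfying [P] outside the current subspace is adjoined until there
    is none; the dimension bounds the number of rounds. As [P] is an arbitrary [Prop], the choice is
    made by excluded middle. *)
Lemma vspace_of_closed (F : fieldType) (V : vectType F) (P : V -> Prop) :
  P 0 -> (forall a u v, P u -> P v -> P (a *: u + v)) ->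
  exists U : {vspace V}, forall v, v \in U <-> P v.
Proof.
move=> P0 PD.
suff H d (U : {vspace V}) : (forall v, v \in U -> P v) ->
    (\dim {:V} - \dim U <= d)%N ->
    exists U : {vspace V}, forall v, v \in U <-> P v.
  apply: (H _ 0%VS _ (leqnn _)) => v.
  by rewrite memv0 => /eqP->.
elim: d U => [|d IHd] U UP dU.
  exists U => v; split=> [/UP//|_].
  suff -> : U = fullv by rewrite memvf.
  by apply/eqP; rewrite eqEdim subvf /= -subn_eq0 -leqn0.
have [UV|] := classic (forall v, P v -> v \in U).
  by exists U => v; split; [apply: UP | apply: UV].
move=> /not_all_ex_not [v nPv].
have [Pv /negP vU] : P v /\ ~ (v \in U) by apply: imply_to_and.
apply: (IHd (U + <[v]>)%VS) => [w /memv_addP[u uU [_ /vlineP[k ->] ->]]|].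
  by rewrite addrC; apply: PD; last exact: UP.
rewrite leq_subLR; move: dU; rewrite leq_subLR => dU.
by rewrite (leq_trans dU) // addnS -addSn leq_add2r dimv_add_line.
Qed.

(** * Rational functionals *)

Section RatCast.
Variable F : fieldType.
Hypothesis chF : [pchar F] =i pred0.

Lemma pchar0_intr_eq0 (m : int) : (m%:~R == 0 :> F) = (m == 0).
Proof.
have nat0 (k : nat) : (k%:R == 0 :> F) = (k == 0)%N by move/pcharf0P: chF => ->.
by case: m => k; rewrite ?NegzE ?rmorphN ?oppr_eq0 /= -pmulrn nat0.
Qed.

(** [ratr] is defined by the reduced fraction; allowing any fraction turns additivity and
    multiplicativity into computations with numerators and denominators. *)
Lemma pchar0_ratr_div (a b : int) :
  b != 0 -> ratr (a%:~R / b%:~R) = a%:~R / b%:~R :> F.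
Proof.
move=> b0; set x := _ / _.
have E : numq x * b = a * denq x.
  apply/eqP; rewrite -(eqr_int rat) !rmorphM /= numqE mulrAC.
  by rewrite divfK // intr_eq0.
apply/eqP; rewrite /ratr eqr_div ?pchar0_intr_eq0 ?denq_neq0 //.
by rewrite -!rmorphM /= E.
Qed.

Lemma pchar0_ratrD (x y : rat) : ratr (x + y) = ratr x + ratr y :> F.
Proof.
have [nx ny] := (denq_neq0 x, denq_neq0 y).
rewrite -[in LHS](divq_num_den x) -[in LHS](divq_num_den y) addf_div ?intr_eq0 //.
rewrite -!rmorphM -rmorphD /= pchar0_ratr_div ?mulf_neq0 //.
by rewrite rmorphD !rmorphM /= -addf_div ?pchar0_intr_eq0.
Qed.

Lemma pchar0_ratrM (x y : rat) : ratr (x * y) = ratr x * ratr y :> F.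
Proof.
have [nx ny] := (denq_neq0 x, denq_neq0 y).
rewrite -[in LHS](divq_num_den x) -[in LHS](divq_num_den y) mulf_div.
by rewrite -!rmorphM /= pchar0_ratr_div ?mulf_neq0 // !rmorphM /= -mulf_div.
Qed.

Lemma pchar0_ratrN (x : rat) : ratr (- x) = - ratr x :> F.
Proof. by rewrite /ratr numqN denqN rmorphN mulNr. Qed.

End RatCast.

Lemma sumr_delta (R : nzRingType) (I : finType) (G : I -> R) k :
  \sum_i (i == k)%:R * G i = G k.
Proof.
rewrite (bigD1 k) //= eqxx mul1r big1 ?addr0 // => i /negPf->.
by rewrite mul0r.
Qed.

(* Here [f] ranges over the rational functionals on the [Q]-span of [lam].
   Applying [f] to the last relation gives [\sum_i d i * f i ^+ 2 = 0], so all
   functionals vanish. *)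
Lemma rational_isotropy (F : fieldType) (n : nat) (lam : 'I_n -> F)
    (d : 'I_n -> nat) :
  [pchar F] =i pred0 -> (forall i, 0 < d i)%N ->
  (forall f : 'I_n -> rat,
     (forall c : 'I_n -> rat, \sum_i ratr (c i) * lam i = 0 ->
        \sum_i c i * f i = 0) ->
     \sum_i ratr (f i) * (lam i *+ d i) = 0) ->
  forall i, lam i = 0.
Proof.
move=> chF d0 lamf i.
have [ratrD ratrM] := (pchar0_ratrD chF, pchar0_ratrM chF).
have ratr0 : ratr 0 = 0 :> F by rewrite /ratr mul0r.
have [U UP] : exists U : {vspace 'rV[rat]_n}, forall v, v \in U <->
    \sum_i ratr (v 0 i) * lam i = 0.
  apply: vspace_of_closed => [|a u v hu hv].
    by rewrite big1 // => j _; rewrite mxE ratr0 mul0r.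
  under eq_bigr do rewrite !mxE ratrD ratrM mulrDl -mulrA.
  by rewrite big_split /= -mulr_sumr hu hv mulr0 addr0.
(* [U], the space of rational relations between the [lam i], is exactly the kernel of [p]. So the
   coordinates of [p] are functionals respecting these relations, and together they detect [U]. *)
pose p := (\1 - projv U)%VF.
have pK v : v \in U -> p v = 0.
  by move=> vU; rewrite /p add_lfunE opp_lfunE id_lfunE projv_id // subrr.
have pU v : p v = 0 -> v \in U.
  rewrite /p add_lfunE opp_lfunE id_lfunE => /eqP.
  by rewrite subr_eq0 => /eqP->; apply: memv_proj.
pose f j k := p (delta_mx 0 k) 0 j.
have fE j (c : 'I_n -> rat) : \sum_k c k * f j k = p (\row_k c k) 0 j.
  rewrite [in RHS](row_sum_delta (\row_k c k)) linear_sum summxE.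
  by apply: eq_bigr => k _; rewrite linearZ !mxE.
have f0 j k : f j k = 0.
  have h1 : \sum_i ratr (f j i) * (lam i *+ d i) = 0.
    apply: lamf => c hc; rewrite fE pK ?mxE //.
    by apply/UP; under eq_bigr do rewrite mxE.
  have h2 : \sum_i (f j i *+ d i) * f j i = 0.
    rewrite fE pK ?mxE //; apply/UP; rewrite -[RHS]h1.
    apply: eq_bigr => l _; rewrite mxE -mulr_natr ratrM ratr_nat.
    by rewrite -mulrA mulr_natl.
  have sq l : 0 <= (f j l *+ d l) * f j l.
    by rewrite mulrnAl mulrn_wge0 // -expr2 sqr_ge0.
  move/eqP: h2; rewrite psumr_eq0 // => /allP/(_ k (mem_index_enum k)) /=.
  rewrite mulf_eq0 mulrn_eq0 => /orP[/orP[/eqP h|]|/eqP//].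
    by have := d0 k; rewrite h.
  by move/eqP.
(* With all functionals zero every row is a relation; the unit row [delta_mx 0 i] says
   [lam i = 0]. *)
have /UP : delta_mx 0 i \in U by apply: pU; apply/rowP=> j; rewrite mxE; apply: f0.
rewrite (bigD1 i) //= big1 ?addr0 => [|j ji].
  by rewrite mxE !eqxx (ratr_nat _ 1) mul1r.
by rewrite mxE (negPf ji) andbF ratr0 mul0r.
Qed.

(** * Interpolation with multiplicities and polynomials in an endomorphism *)

Lemma coprimep_prod_XsubC_exp (F : fieldType) (a : F) (s : seq F) (N : nat) :
  a \notin s ->
  coprimep (('X - a%:P) ^+ N) (\prod_(b <- s) ('X - b%:P) ^+ N).
Proof.
elim: s => [_|b s IHs]; first by rewrite big_nil coprimep1.
rewrite inE negb_or big_cons coprimepMr => /andP[ab /IHs ->].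
by rewrite coprimep_expl ?coprimep_expr ?coprimep_XsubC2 // subr_eq0 eq_sym.
Qed.

(** Chinese remainder theorem for the pairwise coprime moduli [('X - mu%:P) ^+ N], one modulus at a
    time. *)
Lemma poly_interpolation (F : fieldType) (s : seq F) (c : F -> F) (N : nat) :
  uniq s -> exists P : {poly F},
  forall mu, mu \in s -> ('X - mu%:P) ^+ N %| P - (c mu)%:P.
Proof.
elim: s => [_|mu0 s IHs /= /andP[mu0s /IHs[P hP]]]; first by exists 0.
pose Q := \prod_(mu <- s) ('X - mu%:P) ^+ N.
have /Bezout_eq1_coprimepP[[u v] /= uv] : coprimep Q (('X - mu0%:P) ^+ N).
  by rewrite coprimep_sym coprimep_prod_XsubC_exp.
(* The correction is a multiple of [Q], which keeps the old congruences, and [u * Q] is [1] modulo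
   the new modulus. *)
exists (P + u * Q * ((c mu0)%:P - P)) => mu; rewrite inE => /orP[/eqP->|mus].
  have {}uv : u * Q = 1 - v * ('X - mu0%:P) ^+ N by rewrite -uv addrK.
  suff -> : P + u * Q * ((c mu0)%:P - P) - (c mu0)%:P
    = v * (P - (c mu0)%:P) * ('X - mu0%:P) ^+ N by rewrite dvdp_mull.
  by rewrite uv; ring.
rewrite addrAC dvdp_add ?hP // mulrAC dvdp_mull // /Q.
by rewrite (big_rem mu) //= dvdp_mulr.
Qed.

Section PolyAction.
Variables (F : fieldType) (V : lmodType F) (T : {linear V -> V}).

(** This is [p(T) v], for an endomorphism of any module because it will serve with [T = lie x] on a
    space of matrices. *)
Definition poly_act (p : {poly F}) (v : V) : V :=
  \sum_(i < size p) p`_i *: iter i T v.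

Lemma poly_act_wide n (p : {poly F}) v : (size p <= n)%N ->
  poly_act p v = \sum_(i < n) p`_i *: iter i T v.
Proof.
move=> pn; rewrite /poly_act (big_ord_widen n (fun i => p`_i *: iter i T v)) //.
rewrite big_mkcond; apply: eq_bigr => i _.
by case: ltnP => // h; rewrite nth_default // scale0r.
Qed.

Lemma poly_actC c v : poly_act c%:P v = c *: v.
Proof. by rewrite (@poly_act_wide 1) ?size_polyC_leq1 // big_ord1 coefC. Qed.

Lemma poly_actD p q v : poly_act (p + q) v = poly_act p v + poly_act q v.
Proof.
set n := maxn (size p) (size q).
rewrite (@poly_act_wide n) ?size_polyD // (@poly_act_wide n p) ?leq_maxl //.
rewrite (@poly_act_wide n q) ?leq_maxr // -big_split /=.
by apply: eq_bigr => i _; rewrite coefD scalerDl.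
Qed.

Lemma poly_act_linear p : linear (poly_act p).
Proof.
have iterP i a u v : iter i T (a *: u + v) = a *: iter i T u + iter i T v.
  by elim: i => //= i ->; rewrite linearP.
move=> a u v; rewrite /poly_act scaler_sumr -big_split /=.
by apply: eq_bigr => i _; rewrite iterP scalerDr !scalerA mulrC.
Qed.

HB.instance Definition _ p := GRing.isLinear.Build F V V *:%R (poly_act p)
  (poly_act_linear p).

Lemma poly_act_XsubC p mu v :
  poly_act (p * ('X - mu%:P)) v = poly_act p (T v - mu *: v).
Proof.
rewrite linearB linearZ /= mulrBr poly_actD; congr (_ + _).
  rewrite (@poly_act_wide (size p).+1) ?(leq_trans (size_polyMleq _ _)) //.
    rewrite big_ord_recl coefMX eqxx scale0r add0r.
    by apply: eq_bigr => i _; rewrite coefMX /= -iterSr.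
  by rewrite size_polyX addn2.
rewrite -mulrN -polyCN mulrC mul_polyC (@poly_act_wide (size p)) ?size_scale_leq //.
rewrite /poly_act -scaleNr scaler_sumr; apply: eq_bigr => i _.
by rewrite coefZ scalerA.
Qed.

Lemma poly_act_XsubC_exp p mu N v :
  poly_act (p * ('X - mu%:P) ^+ N) v
  = poly_act p (iter N (fun w => T w - mu *: w) v).
Proof.
elim: N p v => [|N IHN] p v; first by rewrite mulr1.
by rewrite exprSr mulrA poly_act_XsubC IHN -iterSr.
Qed.

(** Multiples of [('X - mu%:P) ^+ N] annihilate the generalized eigenvector [v], so only the
    remainder [c] acts. *)
Lemma poly_act_eigen P mu c N v :
  ('X - mu%:P) ^+ N %| P - c%:P ->
  iter N (fun w => T w - mu *: w) v = 0 -> poly_act P v = c *: v.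
Proof.
case/dvdpP=> q hq v0; rewrite -[P](subrK c%:P) hq poly_actD poly_actC.
by rewrite poly_act_XsubC_exp v0 linear0 add0r.
Qed.

End PolyAction.

(** * Engel's theorem *)

Section Engel.
Variables (F : fieldType) (n : nat).
Local Notation M := 'M[F]_n.+1.
Implicit Types (g h : {vspace M}) (a b v x z : M) (s : seq M).

Definition lie a b : M := a * b - b * a.

Lemma lieC a b : lie a b = - lie b a.
Proof. by rewrite /lie opprB. Qed.

Lemma liexx a : lie a a = 0.
Proof. exact: subrr. Qed.

Lemma lieDl a b v : lie (a + b) v = lie a v + lie b v.
Proof. by rewrite /lie mulrDl mulrDr opprD addrACA. Qed.

Lemma lieDr a b v : lie v (a + b) = lie v a + lie v b.
Proof. by rewrite /lie mulrDl mulrDr opprD addrACA. Qed.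

Lemma lieZl c a b : lie (c *: a) b = c *: lie a b.
Proof. by rewrite /lie -scalerAl -scalerAr scalerBr. Qed.

Lemma lieZr c a b : lie a (c *: b) = c *: lie a b.
Proof. by rewrite /lie -scalerAl -scalerAr scalerBr. Qed.

Definition lie_closed h : Prop := forall a b, a \in h -> b \in h -> lie a b \in h.

(** Engel's flag in matrix form: it grows with [j] ([killedW]), a letter of [h] lowers the index by
    one ([killedS]), and [killed h j 1] means that all words of length [j] are zero. *)
Definition killed h j v : Prop :=
  forall s, size s = j -> {subset s <= h} -> (\prod_(a <- s) a) * v = 0.

Definition killed_right h j v : Prop :=
  forall s, size s = j -> {subset s <= h} -> v * (\prod_(a <- s) a) = 0.

Lemma killed0 h v : killed h 0 v <-> v = 0.
Proof.
split=> [/(_ [::])|-> s]; last by rewrite mulr0.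
by rewrite big_nil mul1r; apply.
Qed.

Lemma killedS h j v : killed h j.+1 v <-> forall a, a \in h -> killed h j (a * v).
Proof.
split=> [hv a ah s ss sh|hv s].
  rewrite mulrA -[_ * a]big_rcons; apply: hv; first by rewrite size_rcons ss.
  by move=> b; rewrite mem_rcons inE => /orP[/eqP->|/sh].
case/lastP: s => // s a; rewrite size_rcons => -[ss] sh.
rewrite big_rcons /= -mulrA; apply: hv => //; first by rewrite sh ?mem_rcons ?mem_head.
by move=> b bs; rewrite sh // mem_rcons inE bs orbT.
Qed.

Lemma killed_rightS h j v a :
  a \in h -> killed_right h j.+1 v -> killed_right h j (v * a).
Proof.
move=> ah hv s ss sh; rewrite -mulrA -[a * _](big_cons _ _ _ _ predT) /=.
apply: hv => /=; first by rewrite ss.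
by move=> b; rewrite inE => /orP[/eqP->|/sh].
Qed.

Lemma killedD h j u v : killed h j u -> killed h j v -> killed h j (u + v).
Proof. by move=> hu hv s ss sh; rewrite mulrDr hu ?hv ?addr0. Qed.

Lemma killedZ h j c v : killed h j v -> killed h j (c *: v).
Proof. by move=> hv s ss sh; rewrite -scalerAr hv ?scaler0. Qed.

Lemma killedMr h j v w : killed h j v -> killed h j (v * w).
Proof. by move=> hv s ss sh; rewrite mulrA hv ?mul0r. Qed.

Lemma killed_rightMl h j v w : killed_right h j v -> killed_right h j (w * v).
Proof. by move=> hv s ss sh; rewrite -mulrA hv ?mulr0. Qed.

Lemma killedW h j v : killed h j v -> killed h j.+1 v.
Proof.
move=> hv [|a s] //= [ss] sh; rewrite big_cons -mulrA hv ?mulr0 //.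
by move=> b bs; rewrite sh // inE bs orbT.
Qed.

(** Moving a letter [a] past [x] costs the term [lie a x], again a letter of [h]. *)
Lemma killed_lie h j x v : (forall a, a \in h -> lie a x \in h) ->
  killed h j v -> killed h j (x * v).
Proof.
move=> hx; elim: j v => [|j IHj] v; first by move=> /killed0->; apply/killed0/mulr0.
move=> /killedS hv; apply/killedS => a ah.
have -> : a * (x * v) = x * (a * v) + lie a x * v.
  by rewrite /lie mulrBl !mulrA addrC subrK.
by apply: killedD; [apply/IHj/hv | apply/hv/hx].
Qed.

(* Modulo [killed h j], a word in [h + <[x]>] acts on [killed h j.+1] as a
   multiple of a power of [x]. *)
Lemma killed_add_line h x m j v : (forall a, a \in h -> lie a x \in h) ->
  x ^+ m = 0 -> killed h j v -> killed (h + <[x]>)%VS (m * j) v.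
Proof.
move=> hx xm; elim: j v => [|j IHj] v.
  by move=> /killed0->; rewrite muln0; apply/killed0.
move=> hv s; rewrite mulnSr => ss sh.
(* The last [m] letters, which act first, send [v] into [killed h j]; the other [m * j] are left to
   the induction hypothesis. *)
rewrite -(cat_take_drop (m * j) s) big_cat /= -mulrA.
apply: (IHj); first last.
- by move=> a /mem_take; apply: sh.
- by rewrite size_takel // ss leq_addr.
have {sh} : {subset drop (m * j) s <= (h + <[x]>)%VS} by move=> a /mem_drop; apply: sh.
have : size (drop (m * j) s) = m by rewrite size_drop ss addKn.
move: (drop _ _) => t st th.
suff [c [r [-> hr]]] : exists c r,
    (\prod_(a <- t) a) * v = c *: (x ^+ (size t) * v) + r /\ killed h j r.
  by rewrite st xm mul0r scaler0 add0r.
elim: t th {ss st s} => [|b t IHt] bth.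
  by exists 1, 0; rewrite big_nil mul1r scale1r addr0; split=> // s *; rewrite mulr0.
have [|c [r [E hr]]] := IHt; first by move=> a ta; rewrite bth // inE ta orbT.
have /memv_addP[a ah [_ /vlineP[d ->] Eb]] := bth b (mem_head _ _).
exists (d * c), (c *: (a * (x ^+ size t * v)) + (a * r + d *: (x * r))); split.
  rewrite big_cons -mulrA E Eb mulrDl !mulrDr -!scalerAl -!scalerAr exprS.
  by rewrite !scalerA -!mulrA addrACA (addrC (c *: _)) -addrA.
apply: killedD; [apply/killedZ | apply: killedD; last exact/killedZ/killed_lie].
  suff /killedS : killed h j.+1 (x ^+ size t * v) by apply.
  elim: (size t) => [|i IHi]; first by rewrite mul1r.
  by rewrite exprS -mulrA; apply: killed_lie.
by move: hr => /killedW/killedS; apply.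
Qed.

(** Letters are added one at a time on either side, so that passing from [z] to
    [lie a z = a * z - z * a] lowers [m] by one. *)
Fixpoint sandwich_killed h m z : Prop :=
  if m is m'.+1 then
    forall a, a \in h -> sandwich_killed h m' (a * z) /\ sandwich_killed h m' (z * a)
  else z = 0.

Lemma sandwich_killedB h m u v :
  sandwich_killed h m u -> sandwich_killed h m v -> sandwich_killed h m (u - v).
Proof.
elim: m u v => [|m IHm] u v /=; first by move=> -> ->; rewrite subrr.
move=> hu hv a ah; have [? ?] := hu a ah; have [? ?] := hv a ah.
by rewrite mulrBr mulrBl; split; apply: IHm.
Qed.

Lemma sandwich_killed0 h m : sandwich_killed h m 0.
Proof. by elim: m => //= m IHm a _; rewrite mulr0 mul0r. Qed.

(** Pigeonhole: among [p + q] letters, [p] fall on the left or [q] on the right. *)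
Lemma sandwich_killedP h p q z :
  killed h p z -> killed_right h q z -> sandwich_killed h (p + q) z.
Proof.
move Em: (p + q)%N => m; elim: m p q z Em => [|m IHm] p q z.
  by case: p => // _ /killed0.
case: p => [|p] Em hp hq.
  by move: hp => /killed0->; apply: sandwich_killed0.
move=> a ah; split.
  by apply: (IHm p q); [case: Em | move/killedS: hp; apply | apply: killed_rightMl].
case: q Em hq => [|q] Em hq.
  have -> : z = 0 by have := hq [::]; rewrite big_nil mulr1; apply.
  by rewrite mul0r; apply: sandwich_killed0.
apply: (IHm p.+1 q); last exact: killed_rightS.
  by move: Em; rewrite addnS => -[].
exact: killedMr.
Qed.

(* The iterated commutators of [z] with [h] are combinations of sandwiches
   [u z v] with [u], [v] words in [h], so they eventually vanish. *)
Lemma normalizer_grows g h k : lie_closed g -> (h <= g)%VS ->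
  killed h k 1 -> ~~ (g <= h)%VS ->
  exists x, [/\ x \in g, x \notin h & forall a, a \in h -> lie a x \in h].
Proof.
move=> gl /subvP hg hk /subvPn[z0 z0g z0h].
have : sandwich_killed h (k + k) z0.
  apply: sandwich_killedP => s ss sh; have := hk s ss sh; rewrite mulr1 => ->.
    by rewrite mul0r.
  by rewrite mulr0.
elim: (k + k)%N z0 z0g z0h => [|m IHm] z zg zh /=.
  by move=> z0; rewrite z0 mem0v in zh.
move=> hz; have [|] := classic (forall a, a \in h -> lie a z \in h).
  by exists z.
move=> /not_all_ex_not[a na]; have [ah /negP azh] := imply_to_and _ _ na.
apply: (IHm (lie a z)) => //; first by apply: gl => //; apply: hg.
by have [? ?] := hz a ah; apply: sandwich_killedB.
Qed.

(** A subalgebra [h] whose long words vanish is enlarged from [0] to [g], each time by a nilpotent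
    element of its normalizer outside [h]. *)
Lemma engel g : lie_closed g -> (forall x, x \in g -> exists m, x ^+ m = 0) ->
  exists k, killed g k 1.
Proof.
move=> gl gnil.
suff H d h k : (h <= g)%VS -> lie_closed h -> killed h k 1 ->
    (\dim g - \dim h <= d)%N -> exists k, killed g k 1.
  apply: (H _ 0%VS 1%N _ _ _ (leqnn _)); first exact: sub0v.
    by move=> a b; rewrite !memv0 => /eqP-> /eqP->; rewrite /lie subrr.
  by apply/killedS => a; rewrite memv0 => /eqP->; apply/killed0; rewrite mul0r.
elim: d h k => [|d IHd] h k hg hl hk dh.
  suff -> : g = h by exists k.
  by apply/esym/eqP; rewrite eqEdim hg /= -subn_eq0 -leqn0.
have [gh|/(normalizer_grows gl hg hk)[x [xg xh hx]]] := boolP (g <= h)%VS.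
  by exists k; have -> : g = h by apply: subv_anti; rewrite gh.
have [m xm] := gnil x xg.
apply: (IHd (h + <[x]>)%VS (m * k)%N).
- by rewrite subv_add hg -memvE.
- move=> _ _ /memv_addP[a ah [_ /vlineP[c ->] ->]] /memv_addP[b bh [_ /vlineP[d' ->] ->]].
  rewrite lieDl !lieDr !(lieZl, lieZr) liexx !scaler0 addr0 (lieC x).
  apply: (subvP (addvSl _ _)); apply/memvD.
    by apply/memvD; [apply: hl | apply/memvZ/hx].
  by apply: memvZ; rewrite memvN hx.
- exact: killed_add_line.
rewrite leq_subLR; move: dh; rewrite leq_subLR => dh.
by rewrite (leq_trans dh) // addnS -addSn leq_add2r dimv_add_line.
Qed.

End Engel.

(** * Nilpotence from vanishing traces *)

Lemma horner_mx_eigen (F : fieldType) n (A : 'M[F]_n.+1) (v : 'rV_n.+1) r p :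
  v *m A = r *: v -> v *m horner_mx A p = p.[r] *: v.
Proof.
move=> vA; elim/poly_ind: p => [|p c IHp]; first by rewrite rmorph0 mulmx0 horner0 scale0r.
rewrite rmorphD rmorphM /= horner_mx_X horner_mx_C mulmxDr mulmxA IHp.
by rewrite -scalemxAl vA mul_mx_scalar hornerMXaddC scalerDl scalerA.
Qed.

(** The characteristic polynomial splits and has only the root [0], so it is a power of ['X]; the
    trace is minus its subleading coefficient. *)
Lemma nilpotent_mxtrace (F : closedFieldType) n (A : 'M[F]_n.+1) m :
  A ^+ m = 0 -> \tr A = 0.
Proof.
move=> Am; have [r Er] := closed_field_poly_normal (char_poly A).
move: Er; rewrite (monicP (char_poly_monic A)) scale1r => Er.
have r0 z : z \in r -> z = 0.
  move=> zr; have : eigenvalue A z by rewrite eigenvalue_root_char Er root_prod_XsubC.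
  case/eigenvalueP=> v vA v0.
  have := horner_mx_eigen 'X^m vA; rewrite rmorphXn /= horner_mx_X Am mulmx0 hornerXn.
  move/esym/eqP; rewrite scaler_eq0 (negPf v0) orbF expf_eq0 => /andP[_ /eqP//].
have AX : char_poly A = 'X^(size r).
  rewrite Er (eq_big_seq (fun=> 'X)) => [|z /r0->]; last by rewrite subr0.
  by rewrite big_const_seq count_predT iter_mulr_1.
apply/eqP; rewrite -oppr_eq0 -(char_poly_trace A) // AX coefXn.
have := size_char_poly A; rewrite AX size_polyXn => -[->].
by rewrite -[X in X == _]mulr1n /= ltn_eqF.
Qed.

(** In the rank factorization of [A], idempotence makes the product of the two factors in reverse
    order the identity of size [\rank A]. *)
Lemma idempotent_mxtrace (F : fieldType) n (A : 'M[F]_n.+1) :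
  A * A = A -> \tr A = (\rank A)%:R.
Proof.
move=> AA; rewrite -[in LHS](mulmx_base A) mxtrace_mulC.
suff -> : row_base A *m col_base A = 1%:M by rewrite mxtrace1.
apply: (row_full_inj (col_base_full A)); apply: (row_free_inj (row_base_free A)).
by rewrite mulmx1 mulmxA mulmx_base -mulmxA mulmx_base.
Qed.

Lemma prod_XsubC_exp_dvd (F : fieldType) (s : seq F) N p : uniq s ->
  (forall a, a \in s -> ('X - a%:P) ^+ N %| p) ->
  \prod_(a <- s) ('X - a%:P) ^+ N %| p.
Proof.
elim: s => [|a s IHs] /=; first by rewrite big_nil dvd1p.
case/andP=> a_s us sp; rewrite big_cons Gauss_dvdp ?sp ?mem_head ?IHs //.
  by move=> b bs; rewrite sp // inE bs orbT.
exact: coprimep_prod_XsubC_exp.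
Qed.

(** No root has multiplicity above [size r], so [char_poly A] divides [p] and Cayley-Hamilton
    applies. *)
Lemma horner_mx_eq0 (F : fieldType) n (A : 'M[F]_n.+1) (r : seq F) p :
  char_poly A = \prod_(a <- r) ('X - a%:P) ->
  (forall a, a \in r -> ('X - a%:P) ^+ size r %| p) -> horner_mx A p = 0.
Proof.
move=> Ar rp; have /dvdpP[q ->] : char_poly A %| p.
  have : \prod_(a <- undup r) ('X - a%:P) ^+ size r %| p.
    by apply: prod_XsubC_exp_dvd; [apply: undup_uniq | move=> a; rewrite mem_undup; apply: rp].
  apply: dvdp_trans; rewrite Ar -prodr_undup_exp_count.
  elim: (undup r) => [|a s IHs]; first by rewrite !big_nil.
  by rewrite !big_cons dvdp_mul ?dvdp_exp2l // count_size.
by rewrite rmorphM /= Cayley_Hamilton mulr0.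
Qed.

(** Each round spends one factor [A] on the left or one factor [B] on the right. For shifts [A], [B]
    of [x] by two eigenvalues, the iterated map is [lie x] minus their difference. *)
Lemma iter_sandwich (R : nzRingType) (A B : R) p q z :
  A ^+ p * z = 0 -> z * B ^+ q = 0 ->
  iter (p + q) (fun w => A * w - w * B) z = 0.
Proof.
have iter0 m : iter m (fun w => A * w - w * B) 0 = 0.
  by elim: m => //= m ->; rewrite mulr0 mul0r subrr.
have iterB m u v : iter m (fun w => A * w - w * B) (u - v)
   = iter m (fun w => A * w - w * B) u - iter m (fun w => A * w - w * B) v.
  elim: m => //= m ->; rewrite mulrBr mulrBl !opprB.
  by rewrite addrACA [in RHS]addrACA; congr (_ + _); rewrite addrC.
move Em: (p + q)%N => m; elim: m p q z Em => [|m IHm] p q z.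
  by case: p => // _; rewrite mul1r.
case: p => [|p] Em; first by rewrite mul1r => ->; rewrite iter0.
case: q Em => [|q] Em; first by rewrite mulr1 => _ ->; rewrite iter0.
move=> Az zB; rewrite iterSr iterB (IHm p q.+1) ?(IHm p.+1 q) ?subrr //.
- by move: Em; rewrite addnS => -[].
- by rewrite mulrA Az mul0r.
- by rewrite -mulrA -exprS.
- by case: Em.
- by rewrite mulrA -exprSr.
by rewrite -mulrA zB mulr0.
Qed.

Section LieLinear.
Variables (F : fieldType) (n : nat) (x : 'M[F]_n.+1).

Lemma lie_linear : linear (lie x).
Proof. by move=> c a b; rewrite lieDr lieZr. Qed.

HB.instance Definition _ := GRing.isLinear.Build F 'M[F]_n.+1 'M[F]_n.+1 *:%R
  (lie x) lie_linear.

End LieLinear.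

Lemma poly_act_stable (F : fieldType) (V : vectType F) (T : {linear V -> V})
    (U : {vspace V}) p v :
  (forall u, u \in U -> T u \in U) -> v \in U -> poly_act T p v \in U.
Proof.
move=> TU vU; apply: memv_suml => i _; apply: memvZ.
by elim: (val i) => //= k; apply: TU.
Qed.

(* With [e i] the spectral projections of [x] and [f] a rational functional on
   the span of its eigenvalues, [y = \sum_i f i *: e i] satisfies
   [lie y = Q (lie x)] for a polynomial [Q] interpolating
   [lam i - lam j |-> f i - f j], hence normalizes [g]; then
   [\tr (x * y) = \sum_i f i * lam i * \rank (e i)] vanishes. *)
Lemma nilpotent_of_trace (F : closedFieldType) n (g : {vspace 'M[F]_n.+1}) x :
  [pchar F] =i pred0 -> (forall b, b \in g -> lie x b \in g) ->
  (forall y, (forall b, b \in g -> lie y b \in g) -> \tr (x * y) = 0) ->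
  exists m, x ^+ m = 0.
Proof.
move=> chF gx xy0.
have [r] := closed_field_poly_normal (char_poly x).
rewrite (monicP (char_poly_monic x)) scale1r => Er.
have sr : size r = n.+1.
  by have := size_char_poly x; rewrite Er size_prod_XsubC => -[].
pose s := undup r; pose lam (i : 'I_(size s)) := s`_i.
have lamr i : lam i \in r by rewrite -mem_undup mem_nth.
have lam_inj i j : (lam i == lam j) = (i == j).
  by rewrite nth_uniq ?undup_uniq.
have x0 p : (forall i, ('X - (lam i)%:P) ^+ n.+1 %| p) -> horner_mx x p = 0.
  move=> hp; apply: (horner_mx_eq0 Er) => a; rewrite -mem_undup sr => ar.
  have ai : (index a s < size s)%N by rewrite index_mem.
  by have := hp (Ordinal ai); rewrite /lam nth_index.
have /fin_all_exists[P hP] : forall i, exists p : {poly F},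
    forall j, ('X - (lam j)%:P) ^+ n.+1 %| p - (j == i)%:R%:P.
  move=> i; have [p hp] := poly_interpolation (fun a => (a == lam i)%:R) n.+1 (undup_uniq r).
  by exists p => j; have := hp (lam j); rewrite lam_inj; apply; rewrite mem_undup.
have hP1 i : ('X - (lam i)%:P) ^+ n.+1 %| P i - 1.
  by have := hP i i; rewrite eqxx.
have hP0 i j : j != i -> ('X - (lam j)%:P) ^+ n.+1 %| P i.
  by move=> ji; have := hP i j; rewrite (negPf ji) subr0.
pose e i := horner_mx x (P i).
have sum_e : \sum_i e i = 1.
  apply/eqP; rewrite -subr_eq0 -(rmorph_sum (horner_mx x)) -(rmorph1 (horner_mx x)).
  rewrite -rmorphB /= x0 // => j; rewrite (bigD1 j) //= addrAC dvdp_add //.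
  apply: (big_ind (fun p => _ %| p)) => [|p q|i]; [exact: dvdp0 | exact: dvdp_add |].
  by rewrite eq_sym; apply: hP0.
(* [q - c%:P] is divisible by the power at [lam i] and [P i] by the powers at the other eigenvalues,
   so their product vanishes at [x]. *)
have eM q c i : ('X - (lam i)%:P) ^+ n.+1 %| q - c%:P ->
    horner_mx x q * e i = c *: e i.
  move=> qc; apply/eqP; rewrite -subr_eq0 -linearZ -rmorphM -rmorphB /=.
  rewrite -mul_polyC -mulrBl x0 // => j.
  by have [->|/hP0] := eqVneq j i; [apply: dvdp_mulr | apply: dvdp_mull].
have eC q i : e i * horner_mx x q = horner_mx x q * e i by rewrite /e -!rmorphM mulrC.
have xE i : x - (lam i)%:M = horner_mx x ('X - (lam i)%:P).
  by rewrite rmorphB /= horner_mx_X horner_mx_C.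
have eN i : (x - (lam i)%:M) ^+ n.+1 * e i = 0.
  by rewrite xE -rmorphXn /= (eM _ 0) ?scale0r // subr0.
have eNr i : e i * (x - (lam i)%:M) ^+ n.+1 = 0.
  by rewrite -[RHS](eN i) xE -rmorphXn eC.
(* On the image of the idempotent [e i], [x] is the scalar [lam i] plus a nilpotent part, which has
   trace zero. *)
have trxe i : \tr (x * e i) = lam i *+ \rank (e i).
  have -> : x * e i = lam i *: e i + (x - (lam i)%:M) * e i.
    by rewrite mulrBl -[_%:M * _]/(_ *m _) mul_scalar_mx addrC subrK.
  rewrite linearD linearZ /= idempotent_mxtrace; last first.
    by rewrite [LHS](eM _ 1) ?scale1r.
  rewrite (@nilpotent_mxtrace _ _ _ n.+1) ?addr0 ?mulr_natr //.
  rewrite exprMn_comm; last first.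
    by rewrite xE; apply/esym/eC.
  by rewrite [e i ^+ _]exprS mulrA eN mul0r.
(* [P i] takes the value [1] at [lam i], so [e i] fixes any eigenvector for [lam i]. *)
have e_rank i : (0 < \rank (e i))%N.
  rewrite lt0n mxrank_eq0.
  have /eigenvalueP[v vx v0] : eigenvalue x (lam i).
    by rewrite eigenvalue_root_char Er root_prod_XsubC.
  apply: contra_neq v0 => ei0; have := horner_mx_eigen (P i) vx.
  rewrite [horner_mx _ _]ei0 mulmx0 => /esym/eqP; rewrite scaler_eq0 => /orP[|/eqP//].
  have /dvdpP[q hq] := hP1 i.
  rewrite -[P i](subrK 1) hq hornerD hornerM horner_exp hornerXsubC subrr expr0n mulr0.
  by rewrite add0r hornerC oner_eq0.
have /(rational_isotropy chF e_rank) lam0 : forall f : 'I_(size s) -> rat,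
    (forall c : 'I_(size s) -> rat, \sum_i ratr (c i) * lam i = 0 ->
       \sum_i c i * f i = 0) ->
    \sum_i ratr (f i) * (lam i *+ \rank (e i)) = 0.
  move=> f hf; pose y := \sum_i ratr (f i) *: e i.
  rewrite -[RHS](xy0 y) => [|b bg].
    rewrite mulr_sumr raddf_sum; apply: eq_bigr => i _.
    by rewrite -scalerAr /= mxtraceZ trxe.
  pose phi i : F := ratr (f i).
  (* [pick] selects some pair of eigenvalues with difference [mu]; [cE] shows that its choice does
     not matter. The value [0] off the differences is a dummy. *)
  pose c mu : F := if [pick p | lam p.1 - lam p.2 == mu] is Some p
    then phi p.1 - phi p.2 else 0.
  have cE i j : c (lam i - lam j) = phi i - phi j.
    rewrite /c; case: pickP => [[k l] /eqP/= E|/(_ (i, j))]; last by rewrite eqxx.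
    (* Two equal differences of eigenvalues give a rational relation with coefficients [D], which
       [f] respects. [D] is generic in the ring because it is read in [rat] and in [F]. *)
    pose D (R : nzRingType) t : R :=
      (t == k)%:R - (t == l)%:R - ((t == i)%:R - (t == j)%:R).
    have DE (R : nzRingType) (G : 'I_(size s) -> R) :
        \sum_t D R t * G t = (G k - G l) - (G i - G j).
      under eq_bigr do rewrite !mulrBl.
      by rewrite !sumrB !sumr_delta.
    have ratD t : ratr (D rat t) = D F t.
      by rewrite /D !(pchar0_ratrD chF, pchar0_ratrN) !ratr_nat.
    have /eqP : \sum_t D rat t * f t = 0.
      by apply: hf; under eq_bigr do rewrite ratD; rewrite DE E subrr.
    rewrite DE subr_eq0 => /eqP/(congr1 (@ratr F)).
    by rewrite !(pchar0_ratrD chF, pchar0_ratrN).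
  pose mus := undup [seq lam p.1 - lam p.2 | p <- enum predT].
  (* Twice [n.+1], since [iter_sandwich] adds the exponents for [e i] on the left and [e j] on the
     right. *)
  have [Q hQ] := poly_interpolation c (n.+1 + n.+1) (undup_uniq mus).
  have QE i j : poly_act (lie x) Q (e i * b * e j)
      = (phi i - phi j) *: (e i * b * e j).
    apply: (poly_act_eigen (mu := lam i - lam j) (N := n.+1 + n.+1)).
      rewrite -cE; apply: hQ; rewrite !mem_undup.
      by apply/mapP; exists (i, j); rewrite ?mem_enum.
    rewrite -[RHS](@iter_sandwich _ (x - (lam i)%:M) (x - (lam j)%:M) n.+1 n.+1
        (e i * b * e j)).
    - apply: eq_iter => w; rewrite mulrBl mulrBr /lie.
      rewrite -![_%:M * _]/(_%:M *m _) -![_ * _%:M]/(_ *m _%:M).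
      rewrite mul_scalar_mx mul_mx_scalar scalerBl !opprD !opprK -!addrA.
      by congr (_ + _); rewrite addrCA.
    - by rewrite !mulrA eN !mul0r.
    by rewrite -!mulrA eNr !mulr0.
  suff -> : lie y b = poly_act (lie x) Q b by apply: poly_act_stable.
  have bE : b = \sum_i \sum_j e i * b * e j.
    rewrite -[LHS]mul1r -sum_e mulr_suml; apply: eq_bigr => i _.
    by rewrite -mulr_sumr sum_e mulr1.
  (* Summed over the blocks, the coefficients [phi i] give [y * b] and the [phi j] give [b * y]. *)
  rewrite [in RHS]bE linear_sum /=.
  under [RHS]eq_bigr => i _.
    rewrite linear_sum /=; under eq_bigr do rewrite QE scalerBl.
    rewrite sumrB -scaler_sumr -mulr_sumr sum_e mulr1; over.
  rewrite sumrB /lie mulr_suml; congr (_ - _).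
    by apply: eq_bigr => i _; rewrite scalerAl.
  rewrite exchange_big mulr_sumr; apply: eq_bigr => j _.
  by rewrite -scaler_sumr -mulr_suml -mulr_suml sum_e mul1r scalerAr.
exists n.+1; rewrite -[x]horner_mx_X -rmorphXn /= x0 // => i.
by rewrite lam0 subr0.
Qed.

(** * Traces and Leibniz algebras *)

Section BasisMatrix.
Variables (F : fieldType) (L : vectType F) (n : nat) (X : n.-tuple L).
Hypothesis basisX : basis_of fullv X.

Definition mx_in_basis (f : L -> L) : 'M[F]_n := \matrix_(i, j) coord X j (f X`_i).

Definition row_in_basis (v : L) : 'rV[F]_n := \row_j coord X j v.

Lemma row_in_basis_eq0 v : row_in_basis v = 0 -> v = 0.
Proof.
move=> v0; rewrite (coord_basis basisX (memvf v)) big1 // => j _.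
by have := congr1 (fun r : 'rV_n => r 0 j) v0; rewrite !mxE => ->; rewrite scale0r.
Qed.

Lemma row_in_basisM (f : {linear L -> L}) v :
  row_in_basis (f v) = row_in_basis v *m mx_in_basis f.
Proof.
apply/rowP=> j; rewrite !mxE {1}(coord_basis basisX (memvf v)) !linear_sum.
by apply: eq_bigr => i _; rewrite !mxE !linearZ.
Qed.

Lemma mx_in_basisM (f : L -> L) (g : {linear L -> L}) :
  mx_in_basis (g \o f) = mx_in_basis f *m mx_in_basis g.
Proof.
apply/matrixP=> i j; rewrite !mxE /=.
rewrite (coord_basis basisX (memvf (f _))) !linear_sum.
by apply: eq_bigr => k _; rewrite !mxE !linearZ.
Qed.

End BasisMatrix.

Lemma square_zero_trace (F : closedFieldType) (L : vectType F)
    (f : {linear L -> L}) :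
  (forall v, f (f v) = 0) -> trace_on fullv f = 0.
Proof.
rewrite /trace_on; move: (vbasisP {:L}); move: (vbasis _); move: (\dim _) => n X.
(* The trace lemma concerns matrices of size [n.+1], so dimension zero is treated apart. *)
case: n X => [|n] X basisX ff0; first by rewrite big_ord0.
transitivity (\tr (mx_in_basis X f)); first by apply: eq_bigr => i _; rewrite mxE.
apply: (@nilpotent_mxtrace _ _ _ 2); rewrite expr2 -[LHS](mx_in_basisM basisX).
by apply/matrixP=> i j; rewrite !mxE /= ff0 linear0.
Qed.

(** A rank-one map [v |-> c v *: w] has trace [c w]. This frees [trace_on fullv] from its fixed
    basis: below, the [w i] form a basis of a subspace. *)
Lemma trace_on_sum (F : fieldType) (L : vectType F) m (c : 'I_m -> {scalar L})
    (w : 'I_m -> L) :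
  trace_on fullv (fun v => \sum_i c i v *: w i) = \sum_i c i (w i).
Proof.
rewrite /trace_on; under eq_bigr do rewrite linear_sum.
rewrite exchange_big; apply: eq_bigr => i _.
rewrite [in RHS](coord_vbasis (memvf (w i))) linear_sum.
by apply: eq_bigr => j _; rewrite !linearZ /= mulrC.
Qed.

(** With [p] the projection to [E], the map [f - p \o f] has square zero, because [f] sends its
    image into [E]; and [p \o f] has its image in [E], where it agrees with [f]. *)
Lemma trace_on_two_step (F : closedFieldType) (L : vectType F)
    (f : {linear L -> L}) (J E : {vspace L}) :
  (forall v, f v \in J) -> (forall v, v \in J -> f v \in E) ->
  (forall v, v \in E -> f v \in E) ->
  trace_on fullv f = trace_on E f.
Proof.
move=> fJ JE EE; pose p := (projv E).
transitivity (trace_on fullv (p \o f) + trace_on fullv (f \- (p \o f))).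
  rewrite /trace_on -big_split /=; apply: eq_bigr => i _.
  by rewrite -linearD /= addrC subrK.
rewrite (square_zero_trace (f := f \- (p \o f))) ?addr0 => [|v] /=; last first.
  suff fw : f (f v - p (f v)) \in E by rewrite [p (f (_ - _))]projv_id ?subrr.
  by rewrite linearB; apply: memvB; [apply: JE | apply/EE/memv_proj].
transitivity (trace_on fullv (fun v => \sum_(i < \dim E)
    (coord (vbasis E) i \o p \o f) v *: (vbasis E)`_i)).
  apply: eq_bigr => i _; congr (coord _ _ _).
  exact: (coord_vbasis (memv_proj E _)).
rewrite trace_on_sum; apply: eq_bigr => i _ /=.
by rewrite [p _]projv_id // EE // vbasis_mem // mem_nth // size_tuple.
Qed.

(** * Ideals, squares and the right multiplications of a Leibniz algebra *)

Section Leibniz.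
Variables (F : fieldType) (L : vectType F) (br : L -> L -> L).
Hypotheses (br_bilinear : bilinear_br br) (leibniz : leibniz_identity br).
Implicit Types (I J U X Y : {vspace L}).

Lemma ad_linear x : linear (ad br x).
Proof. by move=> a u v; apply: br_bilinear.1. Qed.

HB.instance Definition _ x := GRing.isLinear.Build F L L *:%R (ad br x) (ad_linear x).

Definition ad_comp x y : {linear L -> L} := ad br x \o ad br y.

Lemma br_linear x : linear (br x).
Proof. by move=> a u v; apply: br_bilinear.2. Qed.

HB.instance Definition _ x := GRing.isLinear.Build F L L *:%R (br x) (br_linear x).

Lemma mem_brs X Y u v : u \in X -> v \in Y -> br u v \in brs br X Y.
Proof.
move=> uX vY; rewrite (coord_vbasis vY) linear_sum.
apply: memv_suml => j _; rewrite linearZ /=; apply: memvZ.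
rewrite (coord_vbasis uX) -[br _ _]/(ad br (vbasis Y)`_j _) linear_sum.
apply: memv_suml => i _; rewrite linearZ; apply/memvZ/memv_span.
by apply/allpairsP; exists ((vbasis X)`_i, (vbasis Y)`_j);
  rewrite !mem_nth ?size_tuple.
Qed.

Lemma brs_subP X Y U :
  (forall u v, u \in X -> v \in Y -> br u v \in U) -> (brs br X Y <= U)%VS.
Proof.
move=> XYU; apply/span_subvP => w /allpairsP[[u v] /= [uX vY ->]].
by apply: XYU; apply: vbasis_mem.
Qed.

Lemma brs_ind X Y (P : L -> Prop) :
  P 0 -> (forall a u v, P u -> P v -> P (a *: u + v)) ->
  (forall u v, u \in X -> v \in Y -> P (br u v)) ->
  forall w, w \in brs br X Y -> P w.
Proof.
move=> P0 PD XYP; have [U UP] := vspace_of_closed P0 PD.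
have /subvP XYU : (brs br X Y <= U)%VS by apply: brs_subP => u v uX vY; apply/UP/XYP.
by move=> w /XYU/UP.
Qed.

Lemma derivedS m I : derived br m.+1 I = brs br (derived br m I) (derived br m I).
Proof. by []. Qed.

Lemma derived_sub m I :
  (forall u v, u \in I -> v \in I -> br u v \in I) -> (derived br m I <= I)%VS.
Proof.
move=> Icl; elim: m => [|m /subvP IHm]; first exact: subvv.
by rewrite derivedS; apply: brs_subP => u v /IHm uI /IHm vI; apply: Icl.
Qed.

(** The Leibniz identity expands both brackets of [br u v] with [y] into brackets of two elements of
    the ideal [D]. *)
Lemma two_sided_ideal_derived m I :
  two_sided_ideal br I -> two_sided_ideal br (derived br m I).
Proof.
move=> Iid; elim: m => // m IHm x y; rewrite derivedS; set D := derived br m I in IHm *.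
move: x; apply: brs_ind; first by rewrite -/(ad br _ _) !linear0 mem0v.
  move=> a u v [hu1 hu2] [hv1 hv2]; split.
    by rewrite -/(ad br _ _) linearP memvD ?memvZ.
  by rewrite linearP memvD ?memvZ.
move=> u v uD vD; have [[uy yu] [vy yv]] := (IHm u y uD, IHm v y vD); split.
  suff -> : br (br u v) y = br u (br v y) + br (br u y) v.
    by apply: memvD; apply: mem_brs.
  by rewrite leibniz subrK.
by rewrite leibniz; apply: memvB; apply: mem_brs.
Qed.

Section Ess.
Variable E : {vspace L}.
Hypothesis essE : is_Ess br E.

(** The Leibniz identity with [y = z] shows that squares lie in the right annihilator, which is a
    subspace. *)
Lemma br_Ess_right x y : y \in E -> br x y = 0.
Proof.
have [U UP] : exists U : {vspace L}, forall v, v \in U <-> forall z, br z v = 0.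
  apply: vspace_of_closed => [z|a u v u0 v0 z]; first by rewrite linear0.
  by rewrite linearP /= u0 v0 scaler0 addr0.
have /subvP EU : (E <= U)%VS.
  by apply: essE.2 => z; apply/UP => t; rewrite leibniz subrr.
by move=> /EU/UP.
Qed.

(** Polarization: for [x] in [E] the square of [x + y] is [br x y + br y y]. *)
Lemma two_sided_ideal_Ess : two_sided_ideal br E.
Proof.
move=> x y xE; rewrite [br y x]br_Ess_right // mem0v; split=> //.
have := essE.1 (x + y).
rewrite linearD /= -/(ad br x (x + y)) -/(ad br y (x + y)) !linearD /= /ad.
rewrite [br y x]br_Ess_right // [br x x]br_Ess_right // addr0 add0r.
by move=> /memvB/(_ (essE.1 y)); rewrite addrK.
Qed.

Lemma solvable_Ess : solvable_sub br E.
Proof.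
exists 1%N; split=> //; apply/eqP; rewrite -subv0; apply: brs_subP => u v _ vE.
by rewrite br_Ess_right ?mem0v.
Qed.

Lemma Ess_unique E' : is_Ess br E' -> E' = E.
Proof.
move: essE => [E1 E2] [E'1 E'2].
by apply: subv_anti; rewrite E'2 // E2.
Qed.

End Ess.

Section KillingBasis.
Variables (n : nat) (X : n.+1.-tuple L).
Hypothesis basisX : basis_of fullv X.

(* Matrices act on row vectors, so that [rho] reverses the order of
   composition; this makes it a morphism to [lie], see [rho_br]. *)
Definition rho (x : L) : 'M[F]_n.+1 := mx_in_basis X (ad br x).

Lemma rho_linear : linear rho.
Proof.
move=> a u v; apply/matrixP=> i j; rewrite !mxE /ad.
by rewrite linearP /= linearP.
Qed.

HB.instance Definition _ := GRing.isLinear.Build F L 'M[F]_n.+1 *:%R rho rho_linear.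

Lemma rho_br y z : rho (br y z) = lie (rho y) (rho z).
Proof.
rewrite /lie -2![_ * _](mx_in_basisM basisX); apply/matrixP=> i j.
by rewrite !mxE /= /ad leibniz linearB.
Qed.

Lemma row_in_basis_br v x : row_in_basis X (br v x) = row_in_basis X v *m rho x.
Proof. exact: (row_in_basisM basisX (ad br x)). Qed.

Lemma mxtrace_rhoM x y :
  \tr (rho y * rho x) = \sum_i coord X i (br (br X`_i y) x).
Proof.
rewrite -[_ * _](mx_in_basisM basisX).
by apply: eq_bigr => i _; rewrite mxE.
Qed.

(* A word of length [k - j] in [rho [N, N]] kills the [j]-th derived term of
   [[N, N]], because [[u, u'] = u . rho u']. *)
Lemma derived_brs_eq0 (N : {vspace L}) (g : {vspace 'M[F]_n.+1}) k :
  (forall u v, u \in N -> v \in N -> br u v \in N) ->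
  (forall u, u \in N -> rho u \in g) -> killed g k 1 -> derived br k N = 0%VS.
Proof.
move=> Ncl rhog gk; apply/eqP; rewrite -subv0; apply/subvP.
have H j : (j <= k)%N -> forall v, v \in derived br j N ->
    forall s, size s = (k - j)%N -> {subset s <= g} ->
    row_in_basis X v *m \prod_(a <- s) a = 0.
  elim: j => [|j IHj] jk v.
    by rewrite subn0 => _ s ss sg; have := gk s ss sg; rewrite mulr1 => ->; rewrite mulmx0.
  move=> + s ss sg; move: v; apply: brs_ind => [|a u v hu hv|u v uD vD].
  - apply/rowP=> i; rewrite [row_in_basis X 0](_ : _ = 0) ?mul0mx //.
    by apply/rowP=> l; rewrite !mxE linear0.
  - rewrite [row_in_basis X _](_ : _ = a *: row_in_basis X u + row_in_basis X v).
      by rewrite mulmxDl -scalemxAl hu hv scaler0 addr0.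
    by apply/rowP=> l; rewrite !mxE linearP.
  rewrite row_in_basis_br -mulmxA -[_ *m (\prod_(_ <- _) _)](big_cons _ _ (rho v) s predT id).
  apply: (IHj (ltnW jk) u uD) => /=; first by rewrite ss -subSn.
  move=> b; rewrite inE => /orP[/eqP->|/sg //].
  by apply: rhog; apply: (subvP (derived_sub j Ncl)).
move=> v vD; rewrite memv0; apply/eqP/(row_in_basis_eq0 basisX).
by have := H k (leqnn k) v vD [::]; rewrite subnn big_nil mulmx1; apply.
Qed.

End KillingBasis.

End Leibniz.

(** Cartan's criterion. If [y] normalizes the image [g] of [N], then
    [\tr (lie a b * y) = \tr (a * lie b y)] is a trace of two elements of [g], hence zero; so
    [nilpotent_of_trace] and [engel] apply to the image of [brs br N N]. *)
Lemma solvable_of_killing (F : closedFieldType) (L : vectType F)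
    (br : L -> L -> L) n (X : n.+1.-tuple L) (N : {vspace L}) :
  [pchar F] =i pred0 -> bilinear_br br -> leibniz_identity br ->
  basis_of fullv X -> (forall u v, u \in N -> v \in N -> br u v \in N) ->
  (forall u v, u \in N -> v \in N -> \tr (rho br X u * rho br X v) = 0) ->
  solvable_sub br N.
Proof.
move=> chF bil lei basisX Ncl trN.
pose rhol := rho_linear bil X; pose rhoB := rho_br bil lei basisX.
have rho0 : rho br X 0 = 0.
  by have := rhol (-1) 0 0; rewrite scaler0 addr0 scaleN1r addNr.
have image_rho (U : {vspace L}) : exists g : {vspace 'M[F]_n.+1},
    forall a, a \in g <-> exists2 u, u \in U & a = rho br X u.
  apply: vspace_of_closed => [|c _ _ [u uU ->] [v vU ->]].
    by exists 0; rewrite ?mem0v.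
  by exists (c *: u + v); [apply/memvD/vU/memvZ | rewrite rhol].
have [[g gP] [g1 g1P]] := (image_rho N, image_rho (brs br N N)).
have NN u : u \in brs br N N -> u \in N.
  by move: u; apply/subvP/brs_subP.
have tr0 u y : u \in brs br N N -> (forall b, b \in g -> lie y b \in g) ->
    \tr (rho br X u * y) = 0.
  move=> + gy; move: u; apply: brs_ind => [|c u v u0 v0|u v uN vN].
  - by rewrite rho0 mul0r linear0.
  - by rewrite rhol mulrDl -scalerAl linearP /= u0 v0 mulr0 addr0.
  rewrite rhoB; set a := rho br X u; set b := rho br X v.
  have -> : \tr (lie a b * y) = \tr (a * lie b y).
    rewrite /lie mulrBl mulrBr !linearB /= !mulrA; congr (_ - _).
    by rewrite [RHS]mxtrace_mulC mulmxA.
  have /gy/gP[w wN E] : b \in g by apply/gP; exists v.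
  by rewrite lieC mulrN linearN /= E trN ?oppr0.
have [k gk] : exists k, killed g1 k 1.
  apply: engel => [_ _ /g1P[u uN ->] /g1P[v vN ->]|_ /g1P[u uN ->]].
    by rewrite -rhoB; apply/g1P; exists (br u v); rewrite // mem_brs ?NN.
  apply: (nilpotent_of_trace (g := g)) => // [_ /gP[v vN ->]|y gy].
    by rewrite -rhoB; apply/gP; exists (br u v) => //; apply: Ncl => //; apply: NN.
  exact: tr0.
(* One derivation leads from [N] to [brs br N N], and [k] more lead to zero. *)
exists k.+1; split=> //; rewrite /derived iterSr.
apply: (derived_brs_eq0 bil basisX _ _ gk) => [u v uN vN|u uN].
  by apply: mem_brs; rewrite ?NN.
by apply/g1P; exists u.
Qed.

Lemma killing_radical (F : closedFieldType) (L : vectType F) (br : L -> L -> L) :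
  [pchar F] =i pred0 -> bilinear_br br -> leibniz_identity br ->
  exists N : {vspace L}, [/\ two_sided_ideal br N, solvable_sub br N &
    forall x, x \in N <-> forall y, killing br x y = 0].
Proof.
move=> chF bil lei; rewrite /killing /trace_on.
move: (vbasisP {:L}); move: (vbasis _); move: (\dim _) => n X.
case: n X => [|n] X basisX.
  have L0 v : v = 0 :> L.
    apply/eqP; have := memvf v.
    by rewrite -(span_basis basisX) (tuple0 X) span_nil memv0.
  exists 0%VS; split=> [x y _||x].
  - by rewrite (L0 (br x y)) (L0 (br y x)) mem0v.
  - exists 1%N; split=> //; apply/eqP; rewrite -subv0; apply/subvP => v _.
    by rewrite (L0 v) mem0v.
  by rewrite (L0 x) mem0v; split=> // _ y; rewrite big_ord0.
pose r := rho br X; pose rhol := rho_linear bil X; pose rhoB := rho_br bil lei basisX.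
have KE x y : \sum_(i < n.+1) coord X i ((ad br x \o ad br y) X`_i) = \tr (r y * r x).
  by rewrite mxtrace_rhoM.
have rho0 : r 0 = 0.
  by have := rhol (-1) 0 0; rewrite scaler0 addr0 scaleN1r addNr.
have [N NP] : exists N : {vspace L}, forall x, x \in N <->
    forall y, \tr (r y * r x) = 0.
  apply: vspace_of_closed => [y|c u v u0 v0 y]; first by rewrite rho0 mulr0 linear0.
  by rewrite /r rhol -/r mulrDr -scalerAr linearP /= u0 v0 mulr0 addr0.
have Nid : two_sided_ideal br N.
  move=> x z /NP x0.
  (* Invariance of the trace form: the bracket with [z] moves from [x] to [y]. *)
  have xz y : \tr (r y * lie (r x) (r z)) = 0.
    rewrite -[RHS](x0 (br z y)) /r !rhoB -/r /lie.
    rewrite mulrBl mulrBr !linearB /= !mulrA; congr (_ - _).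
    by rewrite [LHS]mxtrace_mulC mulmxA.
  split; apply/NP => y; rewrite /r rhoB -/r ?xz //.
  by rewrite lieC mulrN linearN /= xz oppr0.
exists N; split=> // [|x]; last by rewrite NP; split=> + y; move=> /(_ y); rewrite KE.
apply: (solvable_of_killing chF bil lei basisX) => u v.
  by move=> uN _; case: (Nid u v uN).
by move=> _ /NP.
Qed.

Lemma ideal_killing_eq0 (F : closedFieldType) (L : vectType F)
    (br : L -> L -> L) (E J : {vspace L}) :
  bilinear_br br -> leibniz_identity br -> is_Ess br E ->
  killing_leibniz br E -> two_sided_ideal br J -> (brs br J J <= E)%VS ->
  forall x, x \in J -> forall y, killing br x y = 0.
Proof.
move=> bil lei essE trE Jid /subvP JJ x xJ y.
have fJ v : ad_comp bil x y v \in J by have [] := Jid x (br v y) xJ.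
have EE z v : v \in E -> br v z \in E.
  by move=> vE; have [] := two_sided_ideal_Ess bil lei essE z vE.
rewrite -(trE x y); apply: (trace_on_two_step fJ) => v vU.
  by apply/JJ/(mem_brs bil (u := br v y)) => //; have [] := Jid v y vU.
exact/EE/EE.
Qed.

Theorem theorem5p2 (F : closedFieldType) (L : vectType F)
    (br : L -> L -> L) (E : {vspace L}) :
  [pchar F] =i pred0 ->
  bilinear_br br ->
  leibniz_identity br ->
  is_Ess br E ->
  killing_leibniz br E ->
  ((forall x : L, (forall y : L, killing br x y = 0) <-> x \in E)
   <-> semisimple br).
Proof.
move=> chF bil lei essE trE.
have Eid := two_sided_ideal_Ess bil lei essE.
split=> [kerE|[R [E' [[Rid Rsol Rmax] /(Ess_unique essE) E'E RE]]] x].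
  exists E, E; split=> //; split=> // [|I Iid [m [_ Im0]]].
    exact: (solvable_Ess bil lei essE).
  (* Here [i] counts from the end of the derived series: the induction climbs from the zero term
     back to [I], and [kerE] puts each ideal [J] with [[J, J]] in [E] into [E]. *)
  suff H i : (i <= m)%N -> (derived br (m - i) I <= E)%VS.
    by have := H m (leqnn m); rewrite subnn.
  elim: i => [|i IHi] im; first by rewrite subn0 Im0 sub0v.
  have {}IHi := IHi (ltnW im); rewrite -(subnSK im) derivedS in IHi.
  apply/subvP => x xJ; apply/kerE.
  by apply: (ideal_killing_eq0 bil lei essE trE _ IHi) xJ; apply: two_sided_ideal_derived.
have [N [Nid Nsol NP]] := killing_radical chF bil lei.
split=> [/NP|xE y].
  by have /subvP := Rmax N Nid Nsol; rewrite RE E'E; apply.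
(* For [x] in [E] the map [ad br x] itself is zero. *)
rewrite /killing /trace_on big1 // => i _.
by rewrite /= {1}/ad (br_Ess_right bil lei essE) ?linear0.
Qed.
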